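(* Consider the radar detection coverage probability of a Swerling 1 target, for a narrow range resolution cell and isotropic antennas, as a function of the bandwidth $BW\in(0,\infty)$, all other parameters being fixed: $$P_{DC}(BW)=\exp\left(\frac{-K_BT_s\,BW\,\gamma}{P_{tx}\,\mathcal{H}(r_t)\,\sigma_{t_{avg}}}\right)\exp\left(-2\pi\rho(1-J)\,r_t\,\frac{c}{2BW}\right).$$ Then the optimum bandwidth, i.e. the value of $BW$ that maximizes $P_{DC}$, is $$BW=\sqrt{\frac{\pi\rho c\,(1-J)\,r_t\,P_{tx}\,\mathcal{H}(r_t)\,\sigma_{t_{avg}}}{K_BT_s\,\gamma}}.$$
   Context: All of the following are positive constants: Boltzmann constant $K_B$, system noise temperature $T_s$, SCNR threshold $\gamma$, transmitted power $P_{tx}$, path loss $\mathcal{H}(r_t)$ at the target distance $r_t$ (with $r_t>0$), mean $\sigma_{t_{avg}}$ of the exponentially distributed (Swerling 1) target cross-section, clutter density $\rho$, and speed of light $c$. The noise power is $N_s=K_BT_sBW$ and the range cell size is $\Delta r=\frac{c}{2BW}$. The quantity $$J=\int_0^\infty \exp\left(\frac{-\gamma\,\sigma_c}{\sigma_{t_{avg}}}\right)P(\sigma_c)\,d\sigma_c,\qquad P(\sigma_c)=\frac{\alpha}{\sigma_{c_{avg}}}\left(\frac{\sigma_c}{\sigma_{c_{avg}}}\right)^{\alpha-1}\exp\left(-\left(\frac{\sigma_c}{\sigma_{c_{avg}}}\right)^{\alpha}\right),$$ with Weibull parameters $\alpha>0$, $\sigma_{c_{avg}}>0$, does not depend on $BW$.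 Here $P_{DC}$ is the probability that the signal to clutter and noise ratio of the target is at least $\gamma$ when clutter scatterers form a homogeneous Poisson point process of intensity $\rho$ with i.i.d. Weibull cross-sections; the displayed formula is its expression with antenna gain $G\equiv1$ and narrow range cell. *)

(* Defs.v *)
From HB Require Import structures.
From mathcomp Require Import all_boot all_order all_algebra.
From mathcomp Require Import all_classical all_reals all_analysis.

Set Implicit Arguments.
Unset Strict Implicit.
Unset Printing Implicit Defensive.

Import Order.TTheory GRing.Theory Num.Theory.
Import numFieldNormedType.Exports.

Local Open Scope classical_set_scope.
Local Open Scope ring_scope.

(** Weibull density with shape [alpha] and scale [scavg].  For [alpha < 1] the
    density is unbounded near [0]; its (junk) value at the single point [0] is
    irrelevant under the Lebesgue integral below. *)
Definition weibull_density (R : realType) (alpha scavg s : R) : R :=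
  alpha / scavg * (s / scavg) `^ (alpha - 1)
  * expR (- ((s / scavg) `^ alpha)).

(** [J], a Lebesgue integral.  The integrand is nonnegative and dominated by
    a probability density, so the real-valued integral never takes its default
    value for a divergent integral. *)
Definition clutter_integral (R : realType) (gamma stavg alpha scavg : R) : R :=
  (\int[@lebesgue_measure R]_(s in `[0, +oo[)
     (expR (- gamma * s / stavg) * weibull_density alpha scavg s))%R.

Definition noise_power (R : realType) (KB Ts BW : R) : R := KB * Ts * BW.

Definition range_cell_size (R : realType) (c BW : R) : R := c / (2 * BW).

(** Detection coverage probability of a Swerling 1 target for isotropic
    antennas and a narrow range cell, as a function of the bandwidth; [H] is
    the path loss as a function of distance and [J] the clutter integral. *)
Definition coverage_probability (R : realType)
    (KB Ts gamma Ptx : R) (H : R -> R) (rt stavg rho c J BW : R) : R :=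
  expR (- noise_power KB Ts BW * gamma / (Ptx * H rt * stavg))
  * expR (- 2 * pi * rho * (1 - J) * rt * range_cell_size c BW).

Definition maximizes_on (T : Type) (R : realType) (D : set T) (f : T -> R)
    (x : T) : Prop :=
  D x /\ forall y, D y -> f y <= f x.

(* Main.v *)
(* The clutter integral [J] is strictly below [1], because the Weibull density
   has mass at most [1] and the factor [expR (- gamma * s / stavg)] is bounded
   away from [1] on a set of positive mass.  Hence the coverage probability is
   [expR (- (a * y + b / y))] with [a, b > 0], and completing the square in
   [a * y + b / y] shows that its only maximizer is [sqrt (b / a)]. *)
Require Import Defs.
From HB Require Import structures.
From mathcomp Require Import all_boot all_order all_algebra.
From mathcomp Require Import all_classical all_reals all_analysis.
From mathcomp Require Import measurable_realfun ring lra.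
Import Order.TTheory GRing.Theory Num.Theory.
Import numFieldNormedType.Exports.
Local Open Scope classical_set_scope.
Local Open Scope ring_scope.

Lemma cvgry_powR (R : realType) (p : R) :
  0 < p -> x `^ p @[x --> +oo] --> +oo.
Proof.
move=> p_gt0; apply/cvgryPge => M; near=> x.
have M1_ge0 : 0 <= `|M| `^ p^-1 by exact: powR_ge0.
have M1_le : `|M| `^ p^-1 <= x by near: x; apply: nbhs_pinfty_ge; exact: num_real.
apply: (le_trans (ler_norm M)).
have -> : `|M| = (`|M| `^ p^-1) `^ p.
  by rewrite -powRrM mulVf ?gt_eqF// powRr1.
by apply: ge0_ler_powR; rewrite ?nnegrE ?(ltW p_gt0)// (le_trans M1_ge0).
Unshelve. all: by end_near. Qed.

Section weibull.
Context (R : realType) (alpha scavg : R).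
Hypotheses (alpha_gt0 : 0 < alpha) (scavg_gt0 : 0 < scavg).

Lemma weibull_density_ge0 s : 0 <= weibull_density alpha scavg s.
Proof. by rewrite !mulr_ge0 ?invr_ge0 ?powR_ge0 ?expR_ge0 ?ltW. Qed.

Lemma measurable_weibull_density :
  measurable_fun setT (weibull_density alpha scavg).
Proof.
have mdiv : measurable_fun setT (fun s : R => s / scavg).
  exact: measurable_funM.
apply: measurable_funM.
  apply: measurable_funM => //.
  exact: (measurableT_comp (@measurable_powR R _)).
apply: measurableT_comp => //; apply: measurableT_comp => //.
exact: (measurableT_comp (@measurable_powR R _)).
Qed.

(** Minus the Weibull survival function is the antiderivative to be used. At [0] the power may have
    infinite slope, whence [0 < x]. *)
Lemma is_derive_weibull_survival (x : R) : 0 < x ->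
  is_derive x 1 (fun s => - expR (- (s / scavg) `^ alpha))
    (weibull_density alpha scavg x).
Proof.
move=> x_gt0.
have xs_gt0 : 0 < x / scavg by exact: divr_gt0.
have dlin : is_derive x 1 (fun s : R => s / scavg) scavg^-1.
  apply: is_derive_eq.
  by rewrite scaler0 add0r /GRing.scale/= mulr1.
have dpow := @is_derive1_comp R (fun t => t `^ alpha) (fun s => s / scavg)
  x _ _ (is_derive1_powR alpha xs_gt0) dlin.
have dexp := @is_derive1_comp R expR _ x _ _ (is_derive_expR _) (is_deriveN dpow).
apply: (is_derive_eq (is_deriveN dexp)).
by rewrite /weibull_density fctE /=; ring.
Qed.

Lemma continuous_weibull_density (x : R) :
  0 < x -> {for x, continuous (weibull_density alpha scavg)}.
Proof.
move=> x_gt0.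
have xs_gt0 : 0 < x / scavg by exact: divr_gt0.
have cdiv : {for x, continuous (fun s : R => s / scavg)}.
  by apply: cvgM; [exact: cvg_id|exact: cvg_cst].
have cpow p : {for x, continuous (fun s : R => (s / scavg) `^ p)}.
  apply: (@continuous_comp _ _ _ (fun s : R => s / scavg) (fun t => t `^ p)) => //.
  apply: differentiable_continuous; apply/derivable1_diffP.
  by apply: ex_derive; exact: is_derive1_powR.
apply: continuousM.
  by apply: continuousM; [exact: cvg_cst|exact: cpow].
apply: (@continuous_comp _ _ _ (fun s : R => - (s / scavg) `^ alpha) expR).
  exact/continuousN/cpow.
exact: continuous_expR.
Qed.

(** The antiderivative tends to [0] at infinity, so only its value at [a] remains. *)
Lemma integral_weibull_tail (a : R) : 0 < a ->
  (\int[lebesgue_measure]_(s in `[a, +oo[) (weibull_density alpha scavg s)%:E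
   = (expR (- (a / scavg) `^ alpha))%:E)%E.
Proof.
move=> a_gt0.
pose F (s : R) : R := - expR (- (s / scavg) `^ alpha).
have dF x : a <= x -> is_derive x 1 F (weibull_density alpha scavg x).
  by move=> ax; apply: is_derive_weibull_survival; exact: lt_le_trans ax.
rewrite (@ge0_continuous_FTC2y _ (weibull_density alpha scavg) F a 0).
- by rewrite sub0e -EFinN opprK.
- by move=> x _; exact: weibull_density_ge0.
- apply: continuous_in_subspaceT => x; rewrite inE/= in_itv/= andbT => ax.
  by apply: continuous_weibull_density; exact: lt_le_trans ax.
- rewrite -oppr0; apply: cvgN.
  apply: (@cvg_comp _ _ _ (fun s => (s / scavg) `^ alpha) (fun t => expR (- t)));
    last exact: cvgr_expR.
  apply: (@cvg_comp _ _ _ (fun s => s / scavg) (fun t => t `^ alpha));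
    last exact: cvgry_powR.
  by apply: gt0_cvgMly; [rewrite invr_gt0|exact: cvg_id].
- by move=> x /ltW /dF ?; exact: ex_derive.
- apply: cvg_at_right_filter; apply: differentiable_continuous.
  by apply/derivable1_diffP; have ? := dF _ (lexx a); exact: ex_derive.
- move=> x; rewrite in_itv/= andbT => /ltW /dF dFx.
  by rewrite derive1E; exact: derive_val.
Qed.

(* The density may blow up at [0], so the fundamental theorem of calculus is
   applied away from [0] and followed by monotone convergence. *)
Lemma integral_weibull_le1 :
  (\int[lebesgue_measure]_(s in `]0%R, +oo[)
     (weibull_density alpha scavg s)%:E <= 1)%E.
Proof.
(* The successor matters: since [0^-1 = 0], starting at [n = 0] would let [0] into the union. *)
pose F (n : nat) : set R := `[n.+1%:R^-1, +oo[%classic.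
have -> : `]0%R, +oo[%classic = \bigcup_n F n.
  apply/seteqP; split=> [x|x [n _]]; rewrite /F /= !in_itv/= !andbT.
    (* The successor of this truncation exceeds [x^-1], so its inverse lies below [x]. *)
    move=> x_gt0; exists (Num.trunc x^-1) => //.
    rewrite /= in_itv/= andbT invf_ple ?posrE//.
    by rewrite ltW// truncnS_gt.
  by apply: lt_le_trans; rewrite invr_gt0.
have cF : (\int[lebesgue_measure]_(s in F i) (weibull_density alpha scavg s)%:E)%E
    @[i --> \oo] --> (\int[lebesgue_measure]_(s in \bigcup_i F i)
       (weibull_density alpha scavg s)%:E)%E.
  apply: ge0_nondecreasing_set_cvg_integral.
  - move=> m n mn; rewrite subsetEset => x; rewrite /F /= !in_itv/= !andbT.
    by apply: le_trans; rewrite lef_pV2 ?posrE// ler_nat ltnS.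
  - by move=> n; exact: measurable_itv.
  - move=> n; apply/measurable_EFinP.
    exact: measurable_funTS measurable_weibull_density.
  - by move=> n x _; rewrite lee_fin weibull_density_ge0.
rewrite -(cvg_lim _ cF)//; apply: lime_le; first by apply/cvg_ex; eexists; exact: cF.
apply: nearW => n; rewrite /F integral_weibull_tail// lee_fin.
by rewrite expR_le1 oppr_le0 powR_ge0.
Qed.

End weibull.

(* On [[1, +oo[], which has positive Weibull mass [q], the exponential factor is
   at most [expR (- k) < 1], so that [J <= (1 - q) + expR (- k) * q < 1]. *)
Lemma clutter_integral_lt1 (R : realType) (gamma stavg alpha scavg : R) :
  0 < gamma -> 0 < stavg -> 0 < alpha -> 0 < scavg ->
  clutter_integral gamma stavg alpha scavg < 1.
Proof.
move=> gamma_gt0 stavg_gt0 alpha_gt0 scavg_gt0.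
pose mu := @lebesgue_measure R.
pose w := weibull_density alpha scavg.
pose k := gamma / stavg.
have k_gt0 : 0 < k by exact: divr_gt0.
pose g (s : R) := expR (- gamma * s / stavg) * w s.
have w_ge0 s : 0 <= w s by exact: weibull_density_ge0.
have g_ge0 s : 0 <= g s by rewrite mulr_ge0 ?expR_ge0.
have mw D : measurable_fun D (EFin \o w).
  by apply/measurable_EFinP; exact: measurable_funTS (measurable_weibull_density _ _ _).
have mg D : measurable_fun D (EFin \o g).
  apply/measurable_EFinP; apply: measurable_funTS; apply: measurable_funM.
    apply: measurableT_comp => //; apply: measurable_funM => //.
  exact: measurable_weibull_density.
(* Used with [b = 1] on []0, 1[] and with [b = expR (- k)] on [[1, +oo[]. *)
have g_le D (b : R) : measurable D -> 0 <= b ->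
    (forall s, D s -> expR (- gamma * s / stavg) <= b) ->
    (\int[mu]_(s in D) (g s)%:E <= b%:E * \int[mu]_(s in D) (w s)%:E)%E.
  move=> mD b_ge0 gb; rewrite -ge0_integralZl//;
    [|exact: mw|by move=> s _; rewrite lee_fin].
  apply: ge0_le_integral => //.
  - by move=> s _; rewrite lee_fin.
  - exact: mg.
  - by apply/measurable_EFinP; apply: measurable_funM => //; apply/measurable_EFinP; exact: mw.
  - by move=> s Ds; rewrite -EFinM lee_fin ler_wpM2r// gb.
have split01 (f : R -> R) : (forall D, measurable_fun D (EFin \o f)) ->
    (forall s, 0 <= f s) ->
    (\int[mu]_(s in `]0%R, +oo[) (f s)%:E =
     \int[mu]_(s in `]0%R, 1%R[) (f s)%:E + \int[mu]_(s in `[1%R, +oo[) (f s)%:E)%E.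
  move=> mf f_ge0; rewrite -ge0_integral_setU//.
  - by rewrite -itv_bndbnd_setU// bnd_simp.
  - exact: mf.
  - by move=> s _; rewrite lee_fin.
  - rewrite disj_set2E; apply/eqP/seteqP; split=> // s [] /=.
    by rewrite !in_itv/= andbT => /andP[_ /lt_geF ->].
pose q := expR (- (1 / scavg) `^ alpha).
have q_gt0 : 0 < q by exact: expR_gt0.
have wq : (\int[mu]_(s in `[1%R, +oo[) (w s)%:E = q%:E)%E.
  exact: integral_weibull_tail.
have w01 : (\int[mu]_(s in `]0%R, 1%R[) (w s)%:E <= (1 - q)%:E)%E.
  have := integral_weibull_le1 _ _ _ alpha_gt0 scavg_gt0.
  rewrite -/mu (split01 w)// wq => le1.
  by rewrite EFinB leeBrDr.
have g01 : (\int[mu]_(s in `]0%R, 1%R[) (g s)%:E <= (1 - q)%:E)%E.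
  apply: le_trans w01; rewrite -[leRHS]mul1e; apply: g_le => // s.
  rewrite /= in_itv/= => /andP[s_gt0 _].
  by rewrite expR_le1 !mulNr oppr_le0 ltW// divr_gt0// mulr_gt0.
have g1 : (\int[mu]_(s in `[1%R, +oo[) (g s)%:E <= (expR (- k) * q)%:E)%E.
  rewrite EFinM -wq; apply: g_le => //.
  move=> s; rewrite /= in_itv/= andbT => s_ge1.
  by rewrite ler_expR !mulNr lerN2 mulrAC ler_peMr// ltW.
have J_lt1 : (\int[mu]_(s in `[0%R, +oo[) (g s)%:E < 1)%E.
  rewrite -integral_itv_obnd_cbnd; last exact: mg.
  rewrite (split01 g)//; apply: (le_lt_trans (leeD g01 g1)).
  rewrite -EFinD lte_fin.
  have : expR (- k) * q < q by rewrite gtr_pMl// expR_lt1 oppr_lt0.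
  lra.
rewrite /clutter_integral /Rintegral -/mu -/g -[ltRHS]/(fine 1%E).
(* Nonnegativity and the bound by [1] make the integral finite, as needed to carry the strict
   inequality through [fine]. *)
have J_ge0 : (0 <= \int[mu]_(s in `[0%R, +oo[) (g s)%:E)%E.
  by apply: integral_ge0 => s _; rewrite lee_fin.
apply: fine_lt => //.
by rewrite ge0_fin_numE// (lt_trans J_lt1)// ltry.
Qed.

(* With [b = a * s ^+ 2], completing the square gives
   [a * y + b / y = 2 * a * s + a * (y - s) ^+ 2 / y]. *)
Lemma maximizes_expR_linear_inverse (R : realType) (a b x : R) :
  0 < a -> 0 < b ->
  maximizes_on `]0, +oo[ (fun y => expR (- (a * y + b / y))) x <->
  x = Num.sqrt (b / a).
Proof.
move=> a_gt0 b_gt0; set s := Num.sqrt _.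
have s_gt0 : 0 < s by rewrite sqrtr_gt0 divr_gt0.
have bE : b = a * s ^+ 2.
  by rewrite sqr_sqrtr ?ltW ?divr_gt0// mulrC divfK// gt_eqF.
have sq y : 0 < y -> a * y + b / y = a * s + b / s + a * (y - s) ^+ 2 / y.
  by move=> y_gt0; rewrite bE; field; rewrite !gt_eqF.
rewrite /maximizes_on /= in_itv/= andbT; split=> [[x_gt0 x_max]|->].
  (* Comparing a maximizer [x] with [s] forces [a * (x - s) ^+ 2 / x <= 0], hence [x = s]. *)
  have := x_max s; rewrite in_itv/= andbT => /(_ s_gt0).
  rewrite ler_expR lerN2 sq// gerDl pmulr_lle0 ?invr_gt0// pmulr_rle0//.
  by move=> le0; apply/eqP; rewrite -subr_eq0 -sqrf_eq0 eq_le le0 sqr_ge0.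
split=> // y; rewrite in_itv/= andbT => y_gt0.
by rewrite ler_expR lerN2 (sq y)// lerDl divr_ge0 ?(ltW y_gt0)// mulr_ge0 ?sqr_ge0 ?ltW.
Qed.

Theorem theorem2 (R : realType)
    (KB Ts gamma Ptx : R) (H : R -> R) (rt stavg rho c alpha scavg : R)
    (KB_gt0 : 0 < KB) (Ts_gt0 : 0 < Ts) (gamma_gt0 : 0 < gamma)
    (Ptx_gt0 : 0 < Ptx) (rt_gt0 : 0 < rt) (Hrt_gt0 : 0 < H rt)
    (stavg_gt0 : 0 < stavg) (rho_gt0 : 0 < rho) (c_gt0 : 0 < c)
    (alpha_gt0 : 0 < alpha) (scavg_gt0 : 0 < scavg) :
  let J := clutter_integral gamma stavg alpha scavg in
  forall BW : R,
    maximizes_on `]0, +oo[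
      (coverage_probability KB Ts gamma Ptx H rt stavg rho c J) BW
    <->
    BW = Num.sqrt (pi * rho * c * (1 - J) * rt * Ptx * H rt * stavg
                   / (KB * Ts * gamma)).
Proof.
move=> J BW.
have J_lt1 : 0 < 1 - J by rewrite subr_gt0; exact: clutter_integral_lt1.
(* [a] is the noise coefficient of the bandwidth and [b] the clutter coefficient of its inverse; the
   [2] of [2 * pi] cancels that of the range cell size. *)
pose a := KB * Ts * gamma / (Ptx * H rt * stavg).
pose b := pi * rho * (1 - J) * rt * c.
have a_gt0 : 0 < a by rewrite divr_gt0 ?mulr_gt0.
have b_gt0 : 0 < b by rewrite !mulr_gt0 ?pi_gt0.
have -> : pi * rho * c * (1 - J) * rt * Ptx * H rt * stavg / (KB * Ts * gamma)
    = b / a.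
  by rewrite /a /b; field; rewrite !gt_eqF.
rewrite -(maximizes_expR_linear_inverse _ _ _ BW a_gt0 b_gt0).
(* The two functions agree on all of [R], not only on []0, +oo[], which allows rewriting inside
   [maximizes_on]. *)
suff -> : coverage_probability KB Ts gamma Ptx H rt stavg rho c J =
    (fun y => expR (- (a * y + b / y))) by [].
apply/funext => y; rewrite /coverage_probability /noise_power /range_cell_size.
rewrite -expRD; congr expR; rewrite /a /b.
have -> : c / (2 * y) = c / 2 * y^-1 by rewrite invfM mulrA.
(* [y] may be [0] here, so its inverse is treated as an atom. *)
by move: y^-1 => z; field; rewrite !gt_eqF.
Qed.
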